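(* There is no critical exponent for continuous Hadamard powers of generalized doubly nonnegative (GDN) matrices; that is, the GDN critical exponent under Hadamard powering does not exist.
   Context: A real $n$-by-$n$ matrix $A$ is called generalized doubly nonnegative (GDN) if it is entrywise nonnegative, diagonalizable, and has nonnegative eigenvalues. For a GDN matrix $A=(a_{ij})$ and a real number $\alpha>0$, the continuous Hadamard power is $A^{(\alpha)} := (a_{ij}^\alpha)$, i.e. the entrywise $\alpha$-th power. The critical exponent of GDN matrices under Hadamard powering would be the least real number $m$ such that for any GDN matrix $A$, $A^{(\alpha)}$ is also GDN for all $\alpha > m$. *)

(* Defs.v *)
From mathcomp Require Import all_boot all_order all_algebra.
From mathcomp Require Import all_classical all_reals all_analysis.

Set Implicit Arguments.
Unset Strict Implicit.
Unset Printing Implicit Defensive.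

Import Order.TTheory GRing.Theory Num.Theory.

Local Open Scope classical_set_scope.
Local Open Scope ring_scope.

(* [diagonalizable A] is diagonalizability over R itself, which forces every
   complex eigenvalue of A to be real; so [eigenvalue A], which ranges over R,
   misses no eigenvalue. *)
Definition is_GDN (R : realType) (n : nat) (A : 'M[R]_n) : Prop :=
  [/\ forall i j, 0 <= A i j,
      diagonalizable A
    & forall a : R, eigenvalue A a -> 0 <= a].

(* For alpha > 0 one has 0 `^ alpha = 0, as usual; [powR] is only meaningful
   here on nonnegative entries. *)
Definition hadamard_pow (R : realType) (n : nat) (A : 'M[R]_n) (alpha : R) :
  'M[R]_n := \matrix_(i, j) (A i j `^ alpha).

(* Hadamard powers are only defined for alpha > 0, and m may be any real
   number, whence the two conditions on alpha. *)
Definition GDN_exponent_bounds (R : realType) (n : nat) : set R :=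
  [set m | forall A : 'M[R]_n, is_GDN A ->
     forall alpha : R, 0 < alpha -> m < alpha -> is_GDN (hadamard_pow A alpha)].

Definition is_least (R : realType) (S : set R) (m : R) : Prop :=
  S m /\ lbound S m.

Definition is_GDN_critical_exponent_of_order (R : realType) (n : nat) (m : R) :
  Prop := is_least (@GDN_exponent_bounds R n) m.

(* Same m for matrices of every order. *)
Definition is_GDN_critical_exponent (R : realType) (m : R) : Prop :=
  is_least [set m' | forall n : nat, @GDN_exponent_bounds R n m'] m.

(* Main.v *)
Require Import Defs.
From mathcomp Require Import all_boot all_order all_algebra.
From mathcomp Require Import all_classical all_reals all_analysis.
From mathcomp Require Import ring lra.
Import Order.TTheory GRing.Theory Num.Theory.
Local Open Scope classical_set_scope.
Local Open Scope ring_scope.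

(** The 3-by-3 matrix with rows (1, 7/4, 0), (1, 1, 3/7), (1, 0, 1) has
    eigenvalues 0, 1/2 and 5/2.  Its Hadamard power of exponent alpha has trace
    3, while the trace of its square is 3 + 2 (7/4)^alpha.  Nonnegative real
    eigenvalues would force tr (B^2) <= (tr B)^2, i.e. (7/4)^alpha <= 3, which
    fails for alpha >= 2.  Padding with zeros gives every order n >= 3. *)

(** The square of a sum of nonnegative eigenvalues exceeds the sum of their squares by cross terms,
    all nonnegative. *)
Lemma GDN_trace_sqr (R : realType) (n : nat) (B : 'M[R]_n) :
  is_GDN B -> \tr (B *m B) <= \tr B ^+ 2.
Proof.
case=> _ [P Pu /(similar_diagLR Pu)[d BE]] Bge0.
rewrite conjVmx// in BE.
have d_ge0 i : 0 <= d 0 i.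
  (* The rows of the diagonalizing [P] are left eigenvectors, nonzero since [P] is invertible. *)
  apply: Bge0; apply/eigenvalueP; exists (row i P).
    by rewrite BE !rowE !mulmxA mulmxK// -[_ *m diag_mx _]rowE row_diag_mx scalemxAl.
  apply/eqP => /(congr1 (fun v => v *m invmx P)).
  rewrite rowE mulmxK// mul0mx => /matrixP/(_ 0 i).
  by rewrite !mxE !eqxx => /eqP; rewrite oner_eq0.
have trB : \tr B = \sum_i d 0 i.
  by rewrite BE mxtrace_mulC !mulmxA mulmxV// mul1mx mxtrace_diag.
have trBB : \tr (B *m B) = \sum_i d 0 i * d 0 i.
  rewrite BE !mulmxA mulmxK// mxtrace_mulC !mulmxA mulmxV// mul1mx.
  by rewrite mulmx_diag mxtrace_diag; apply: eq_bigr => i _; rewrite mxE.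
rewrite trBB trB expr2 mulr_suml; apply: ler_sum => i _.
rewrite ler_wpM2l// (bigD1 i)//= lerDl.
by apply: sumr_ge0.
Qed.

Definition pad_mx (R : nmodType) (m k : nat) (A : 'M[R]_m) : 'M[R]_(m + k) :=
  block_mx A 0 0 0.
Arguments pad_mx {R m} k A.

Lemma hadamard_pow_pad (R : realType) (m k : nat) (A : 'M[R]_m) (alpha : R) :
  alpha != 0 ->
  hadamard_pow (pad_mx k A) alpha = pad_mx k (hadamard_pow A alpha).
Proof.
move=> alpha0; apply/matrixP => i j; rewrite !mxE.
by case: splitP => i' _; rewrite !mxE; case: splitP => j' _;
  rewrite !mxE// powR0.
Qed.

(** The unshifted factor, for the eigenvalue 0, kills the padding block; the shifted ones alone
    would leave a scalar there. *)
Lemma pad_mx_cubic (R : nzRingType) (m k : nat) (A : 'M[R]_m) (b c : R) :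
  pad_mx k A *m (pad_mx k A - b%:M) *m (pad_mx k A - c%:M) =
  pad_mx k (A *m (A - b%:M) *m (A - c%:M)).
Proof.
rewrite /pad_mx !scalar_mx_block !opp_block_mx !add_block_mx !mulmx_block.
by rewrite !(oppr0, addr0, mul0mx, mulmx0).
Qed.

Lemma horner_mx_cubic (R : comNzRingType) (n : nat) (A : 'M[R]_n.+1) (b c : R) :
  horner_mx A ('X * ('X - b%:P) * ('X - c%:P)) =
  A *m (A - b%:M) *m (A - c%:M).
Proof. by rewrite !rmorphM !rmorphB /= horner_mx_X !horner_mx_C. Qed.

(** All entries but [x] and [z] are 0 or 1, so positive Hadamard powers stay in this family. In
    [s = t - 1] the characteristic polynomial is [s^3 - x s - x z]. *)
Definition mx3 {R : nzRingType} (x z : R) : 'M[R]_3 :=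
  \matrix_(i, j)
    nth 0 (nth [::] [:: [:: 1; x; 0]; [:: 1; 1; z]; [:: 1; 0; 1]] i) j.

Lemma hadamard_pow_mx3 (R : realType) (x z alpha : R) : alpha != 0 ->
  hadamard_pow (mx3 x z) alpha = mx3 (x `^ alpha) (z `^ alpha).
Proof.
move=> a0; apply/matrixP => i j; rewrite !mxE.
by case: i => [[|[|[|//]]] ?]; case: j => [[|[|[|//]]] ?] /=;
  rewrite ?powR0 ?powR1.
Qed.

Lemma mxtrace_mx3 (R : comNzRingType) (x z : R) : \tr (mx3 x z) = 3%:R.
Proof. by rewrite /mxtrace !big_ord_recl big_ord0 !mxE /=; ring. Qed.

Lemma mxtrace_mx3_sqr (R : comNzRingType) (x z : R) :
  \tr (mx3 x z *m mx3 x z) = 3%:R + 2%:R * x.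
Proof.
rewrite /mxtrace !big_ord_recl big_ord0 !mxE !big_ord_recl !big_ord0 !mxE /=.
by ring.
Qed.

(** Here [s^3 - (7/4) s - 3/4] has the roots -1, -1/2 and 3/2. *)
Definition witness {R : realType} : 'M[R]_3 := mx3 (7 / 4) (3 / 7).

Lemma witness_annihilated (R : realType) :
  witness *m (witness - (1 / 2)%:M) *m (witness - (5 / 2)%:M) = 0 :> 'M[R]_3.
Proof.
apply/matrixP => i j.
case: i => [[|[|[|//]]] ?]; case: j => [[|[|[|//]]] ?];
  do 3 rewrite ?mxE ?big_ord_recl ?big_ord0; rewrite /= ?mulr1n ?mulr0n; by field.
Qed.

(** One annihilating polynomial with distinct nonnegative roots yields both diagonalizability and
    the sign of the eigenvalues. *)
Lemma GDN_witness (R : realType) (k : nat) : is_GDN (pad_mx k (@witness R)).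
Proof.
set A := pad_mx k _.
have annA : mxminpoly A %| \prod_(x <- [:: 0; 1 / 2; 5 / 2]) ('X - x%:P).
  rewrite dvd_mxminpoly !big_cons big_nil mulr1 subr0 mulrA.
  apply/eqP; rewrite horner_mx_cubic.
  apply: etrans (pad_mx_cubic _ _ _ witness _ _) _.
  by rewrite witness_annihilated; apply: block_mx0.
split.
- move=> i j; rewrite mxE; case: splitP => i' _; rewrite !mxE;
    case: splitP => j' _; rewrite !mxE//.
  case: i' => [[|[|[|//]]] ?]; case: j' => [[|[|[|//]]] ?] /=; lra.
- apply/diagonalizableP; exists [:: 0; 1 / 2; 5 / 2] => //=.
  rewrite !inE !negb_or andbT -!andbA; apply/and3P; split; apply/eqP; lra.
- move=> a; rewrite eigenvalue_root_min => ra.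
  have : root (\prod_(x <- [:: 0; 1 / 2; 5 / 2]) ('X - x%:P)) a.
    exact: root_dvdp ra.
  rewrite root_prod_XsubC !inE => /or3P[] /eqP ->; lra.
Qed.

Lemma hadamard_pow_witness_not_GDN (R : realType) (k : nat) (alpha : R) :
  2 <= alpha -> ~ is_GDN (hadamard_pow (pad_mx k witness) alpha).
Proof.
move=> a2; have a0 : alpha != 0 by apply/eqP; lra.
rewrite hadamard_pow_pad// hadamard_pow_mx3// => /GDN_trace_sqr.
rewrite /pad_mx mulmx_block !(mulmx0, mul0mx, addr0) !mxtrace_block.
rewrite !mxtrace0 !addr0 mxtrace_mx3 mxtrace_mx3_sqr.
(* Already [(7/4)^2 = 49/16] exceeds 3. *)
have : (7 / 4 : R) `^ 2%:R <= (7 / 4) `^ alpha by apply: ler_powR => //; lra.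
by rewrite powR_mulrn; lra.
Qed.

Lemma GDN_exponent_bounds_set0 (R : realType) (n : nat) : (3 <= n)%N ->
  GDN_exponent_bounds n = set0 :> set R.
Proof.
move=> /subnKC <-; apply/seteqP; split=> // m mP.
(* As [m] may be negative or small, the maximum secures [alpha >= 2] as well as [alpha > m]. *)
set alpha : R := Num.max 2 (m + 1).
have le2 : 2 <= alpha by rewrite le_max lexx.
have lem : m + 1 <= alpha by rewrite le_max lexx orbT.
apply: (@hadamard_pow_witness_not_GDN R (n - 3) alpha) => //.
by apply: mP; [exact: GDN_witness | lra | lra].
Qed.

Theorem mainTheorem5 (R : realType) :
  (~ exists m : R, is_GDN_critical_exponent m) /\
  (forall n : nat, (3 <= n)%N ->
     (~ exists m : R, is_GDN_critical_exponent_of_order n m) /\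
     GDN_exponent_bounds n = set0 :> set R).
Proof.
(* No least bound exists because there is no bound at all; for all orders together, order 3
   suffices. *)
have empty (n : nat) (m : R) : (3 <= n)%N -> ~ @GDN_exponent_bounds R n m.
  by move=> /(GDN_exponent_bounds_set0 R) ->.
split; first by case=> m [mP _]; exact: (empty 3%N m isT (mP 3%N)).
move=> n n3; split; last exact: GDN_exponent_bounds_set0.
by case=> m [mP _]; exact: (empty n m n3).
Qed.
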